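(* Let $f=\frac1n\sum_{i=1}^n f_i:\mathbb{R}^d\to\mathbb{R}$ with each $f_i$ continuously differentiable. Assume (i) there is $f^\star\in\mathbb{R}$ with $f(x)\ge f^\star$ for all $x$; (ii) each $f_i$ has ${\bm L}_i$-Lipschitz gradient and $f$ has ${\bm L}$-Lipschitz gradient, where ${\bm L}_i,{\bm L}\in\mathbb{S}^d_{++}$. Let $p\in(0,1]$, let $\mathcal S$ be the sketch distribution, and let ${\bm D}\in\mathbb{S}^d_{++}$ satisfy $$ {\bm D}^{-1}\succeq\left(\frac{(1-p)\,R({\bm D},\mathcal S)}{np}+1\right){\bm L},$$ where $$R({\bm D},\mathcal S):=\frac1n\sum_{i=1}^n\lambda_{\max}({\bm L}_i)\,\lambda_{\max}\!\left({\bm L}^{-1/2}{\bm L}_i{\bm L}^{-1/2}\right)\,\lambda_{\max}\!\left(\mathbb{E}[{\bm S}{\bm D}{\bm S}]-{\bm D}\right),\quad {\bm S}\sim\mathcal S.$$ Then after $K\ge1$ iterations of det-MARINA, $$\mathbb{E}\left[\|\nabla f(\tilde x^K)\|^2_{{\bm D}/\det({\bm D})^{1/d}}\right]\le\frac{2\,(f(x^0)-f^\star)}{\det({\bm D})^{1/d}\,K}.$$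
   Context: Notation: $\mathbb{S}^d_{++}$ ($\mathbb{S}^d_+$) is the set of symmetric positive definite (semidefinite) $d\times d$ matrices; for a symmetric matrix ${\bm M}$, $\|x\|_{\bm M}^2:=x^\top{\bm M}x$; $\lambda_{\max}$ denotes the largest eigenvalue. A differentiable $g:\mathbb{R}^d\to\mathbb{R}$ has ${\bm L}$-Lipschitz gradient (${\bm L}\in\mathbb{S}^d_{++}$) if $\|\nabla g(x)-\nabla g(y)\|_{{\bm L}^{-1}}\le\|x-y\|_{\bm L}$ for all $x,y$. Sketches: $\mathcal S$ is a distribution over random matrices in $\mathbb{S}^d_+$ with $\mathbb{E}[{\bm S}]={\bm I}_d$ and finite second moments; all sketches ${\bm S}_i^k$ ($i=1,\dots,n$, $k\ge0$) are i.i.d. from $\mathcal S$ and independent of everything else. Algorithm det-MARINA (input $x^0$, ${\bm D}$, $p$, $K$): set $g^0=\nabla f(x^0)$. For $k=0,\dots,K-1$: sample $c_k\sim\mathrm{Bernoulli}(p)$ independently; set $x^{k+1}=x^k-{\bm D}g^k$; for each $i$, set $g_i^{k+1}=\nabla f_i(x^{k+1})$ if $c_k=1$, and $g_i^{k+1}=g^k+{\bm S}_i^k(\nabla f_i(x^{k+1})-\nabla f_i(x^k))$ if $c_k=0$; set $g^{k+1}=\frac1n\sum_i g_i^{k+1}$. Output $\tilde x^K$ chosen uniformly at random from $\{x^0,\dots,x^{K-1}\}$. The expectation is over all randomness (coins, sketches, output index). *)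

(* Defs.v *)
From HB Require Import structures.
From mathcomp Require Import all_boot all_order all_algebra.
From mathcomp Require Import all_classical all_reals all_analysis.
Set Implicit Arguments. Unset Strict Implicit. Unset Printing Implicit Defensive.
Import Order.TTheory GRing.Theory Num.Theory.
Import numFieldNormedType.Exports.
Local Open Scope classical_set_scope.
Local Open Scope ring_scope.

Section Defs.
Variable R : realType.
Variable d : nat.

Definition qf (M : 'M[R]_d) (x : 'cV[R]_d) : R := (x^T *m M *m x) 0 0.
Definition mnorm (M : 'M[R]_d) (x : 'cV[R]_d) : R := Num.sqrt (qf M x).

Definition symmx (M : 'M[R]_d) : Prop := M^T = M.
Definition psdmx (M : 'M[R]_d) : Prop := symmx M /\ forall x, 0 <= qf M x.
Definition pdmx (M : 'M[R]_d) : Prop :=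
  symmx M /\ forall x, x != 0 -> 0 < qf M x.

Definition lambda_max (M : 'M[R]_d) : R := sup [set a : R | eigenvalue M a].

Definition psd_sqrt (M : 'M[R]_d) : 'M[R]_d :=
  xget 0 [set X : 'M[R]_d | psdmx X /\ X *m X = M].

Definition is_gradient (f : 'cV[R]_d -> R) (g : 'cV[R]_d -> 'cV[R]_d) : Prop :=
  forall x, differentiable f x /\ forall v, 'd f x v = ((g x)^T *m v) 0 0.

Definition lipschitz_grad (L : 'M[R]_d) (g : 'cV[R]_d -> 'cV[R]_d) : Prop :=
  forall x y, mnorm (invmx L) (g x - g y) <= mnorm L (x - y).

Variables (dO : measure_display) (Omega : measurableType dO)
          (mu : probability Omega R) (sigma : Omega -> 'M[R]_d).

Definition is_sketch_distribution : Prop :=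
  (forall i j, measurable_fun setT (fun w => sigma w i j)) /\
  (forall w, psdmx (sigma w)) /\
  (forall i j, mu.-integrable setT (fun w => (sigma w i j)%:E)) /\
  (forall i j, Rintegral mu setT (fun w => sigma w i j) = (i == j)%:R) /\
  (forall i j, mu.-integrable setT (fun w => ((sigma w i j) ^+ 2)%:E)).

Definition Emx (F : 'M[R]_d -> 'M[R]_d) : 'M[R]_d :=
  \matrix_(i, j) Rintegral mu setT (fun w => F (sigma w) i j).

(* expectation over m independent sketches s 0, ..., s (m-1) *)
Fixpoint Eprod (m : nat) (F : (nat -> 'M[R]_d) -> \bar R) : \bar R :=
  match m with
  | 0 => F (fun _ => 0)
  | m'.+1 => (\int[mu]_w Eprod m' (fun s => F (fun j => if j == m' then sigma w else s j)))%E
  end.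

Variables (n : nat) (gf : 'I_n -> 'cV[R]_d -> 'cV[R]_d) (D : 'M[R]_d) (p : R)
          (h : 'cV[R]_d -> R).

Definition gradf (x : 'cV[R]_d) : 'cV[R]_d := n%:R^-1 *: \sum_i gf i x.

(* W m x g = E[ sum_{j<m} h(x^j) ] for det-MARINA started from the state
   (x^0, g^0) = (x, g) (coins c_k ~ Bernoulli p, sketches i.i.d. ~ sigma). *)
Fixpoint W (m : nat) (x g : 'cV[R]_d) : \bar R :=
  match m with
  | 0 => 0%E
  | m'.+1 =>
    let x' := x - D *m g in
    ((h x)%:E
     + p%:E * W m' x' (gradf x')
     + (1 - p)%:E *
       Eprod n (fun s => W m' x'
         (n%:R^-1 *: \sum_(i < n) (g + s (nat_of_ord i) *m (gf i x' - gf i x)))))%E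
  end.

End Defs.

(* Main.v *)
(** The function Phi(x, g) = f(x) - f* + |g - grad f(x)|_D^2 / (2p) is a Lyapunov
    function for det-MARINA.  Smoothness of f in the L-norm gives, for the step
    x' = x - D g,
      f(x') <= f(x) - |grad f(x)|_D^2 / 2 + |g - grad f(x)|_D^2 / 2
               - (|x' - x|_{D^-1}^2 - |x' - x|_L^2) / 2,
    and since the sketches are independent and unbiased, a compressed step raises
    the expected squared error |g - grad f|_D^2 by at most (R(D,S)/n) |x' - x|_L^2.
    The condition on D makes the terms in |x' - x| cancel, so Phi decreases in
    expectation by at least |grad f(x)|_D^2 / 2 per iteration; telescoping and
    Phi >= 0 bound the expected sum of the |grad f(x^k)|_D^2 by
    2 Phi(x^0, grad f(x^0)) = 2 (f(x^0) - f* ). *)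
Require Import Defs.
From HB Require Import structures.
From mathcomp Require Import all_boot all_order all_algebra.
From mathcomp Require Import all_classical all_reals all_analysis.
From mathcomp Require Import complex measurable_realfun.
From mathcomp Require Import ring lra.
Set Implicit Arguments. Unset Strict Implicit. Unset Printing Implicit Defensive.
Import Order.TTheory GRing.Theory Num.Theory.
Import numFieldNormedType.Exports.
Local Open Scope classical_set_scope.
Local Open Scope ring_scope.

(** * Bilinear and quadratic forms of real matrices *)

Section QuadraticForms.
Variables (R : realType) (d : nat).
Implicit Types (M A B : 'M[R]_d) (x y : 'cV[R]_d) (a : R).

Definition bf M x y : R := (x^T *m M *m y) 0 0.

Lemma bfxx M x : bf M x x = qf M x. Proof. by []. Qed.

Lemma bfDl M x1 x2 y : bf M (x1 + x2) y = bf M x1 y + bf M x2 y.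
Proof. by rewrite /bf linearD /= !mulmxDl mxE. Qed.

Lemma bfDr M x y1 y2 : bf M x (y1 + y2) = bf M x y1 + bf M x y2.
Proof. by rewrite /bf mulmxDr mxE. Qed.

Lemma bfZl M a x y : bf M (a *: x) y = a * bf M x y.
Proof. by rewrite /bf linearZ /= -!scalemxAl mxE. Qed.

Lemma bfZr M a x y : bf M x (a *: y) = a * bf M x y.
Proof. by rewrite /bf -scalemxAr mxE. Qed.

Lemma bfNl M x y : bf M (- x) y = - bf M x y.
Proof. by rewrite -scaleN1r bfZl mulN1r. Qed.

Lemma bfNr M x y : bf M x (- y) = - bf M x y.
Proof. by rewrite -scaleN1r bfZr mulN1r. Qed.

Lemma bfC M x y : symmx M -> bf M x y = bf M y x.
Proof.
move=> sM; rewrite /bf; transitivity ((x^T *m M *m y)^T 0 0); first by rewrite [RHS]mxE.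
by rewrite !trmx_mul trmxK sM mulmxA.
Qed.

Lemma bf_mulr M A x y : bf M x (A *m y) = bf (M *m A) x y.
Proof. by rewrite /bf !mulmxA. Qed.

Lemma bf_mull M A x y : bf M (A *m x) y = bf (A^T *m M) x y.
Proof. by rewrite /bf trmx_mul !mulmxA. Qed.

Lemma qfMD A B x : qf (A + B) x = qf A x + qf B x.
Proof. by rewrite /qf mulmxDr mulmxDl mxE. Qed.

Lemma qfMZ a A x : qf (a *: A) x = a * qf A x.
Proof. by rewrite /qf -scalemxAr -scalemxAl mxE. Qed.

Lemma qfMB A B x : qf (A - B) x = qf A x - qf B x.
Proof. by rewrite qfMD -scaleN1r qfMZ mulN1r. Qed.

Lemma qfD M x y : symmx M -> qf M (x + y) = qf M x + 2 * bf M x y + qf M y.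
Proof.
move=> sM; rewrite -!bfxx bfDl !bfDr (bfC y x sM); ring.
Qed.

Lemma qfZ M a x : qf M (a *: x) = a ^+ 2 * qf M x.
Proof. by rewrite -!bfxx bfZl bfZr mulrA expr2. Qed.

Lemma qfN M x : qf M (- x) = qf M x.
Proof. by rewrite -scaleN1r qfZ sqrrN expr1n mul1r. Qed.

Lemma qf_mulmx M A x : qf M (A *m x) = qf (A^T *m M *m A) x.
Proof. by rewrite -!bfxx bf_mulr bf_mull mulmxA. Qed.

Lemma qf1E x : qf 1%:M x = \sum_i x i 0 ^+ 2.
Proof. by rewrite /qf mulmx1 mxE; apply: eq_bigr => i _; rewrite !mxE expr2. Qed.

Lemma qf_eigenvector M a (v : 'rV[R]_d) :
  v *m M = a *: v -> qf M v^T = a * qf 1%:M v^T.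
Proof. by move=> vM; rewrite /qf trmxK vM mulmx1 -scalemxAl mxE. Qed.

Lemma qf1_ge0 x : 0 <= qf 1%:M x.
Proof. by rewrite qf1E; apply: sumr_ge0 => i _; exact: sqr_ge0. Qed.

Lemma qf1_gt0 x : x != 0 -> 0 < qf 1%:M x.
Proof.
move=> x0; rewrite lt_neqAle qf1_ge0 andbT eq_sym; apply: contra x0.
rewrite qf1E psumr_eq0; last by move=> i _; exact: sqr_ge0.
move=> /allP h; apply/eqP/matrixP => i j; rewrite ord1 mxE.
by have := h i (mem_index_enum i); rewrite implyTb sqrf_eq0 => /eqP.
Qed.

Lemma pdmx_psdmx A : pdmx A -> psdmx A.
Proof.
move=> [sA pA]; split=> // x; have [->|/pA/ltW//] := eqVneq x 0.
by rewrite /qf mulmx0 mxE.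
Qed.

(** Nonnegativity of the form at [qf M v *: u - bf M u v *: v] gives the inequality multiplied by
    [qf M v]; this factor cancels as soon as the form is positive at [x] or at [y]. *)
Lemma psdmx_cauchy_schwarz M x y : psdmx M -> bf M x y ^+ 2 <= qf M x * qf M y.
Proof.
move=> [sM pM].
have key u v : qf M v * bf M u v ^+ 2 <= qf M v * (qf M u * qf M v).
  have := pM (qf M v *: u + (- bf M u v) *: v).
  rewrite qfD// !qfZ bfZl bfZr; set a := qf M u; set b := qf M v; set c := bf M u v.
  rewrite -subr_ge0 => h; rewrite -subr_ge0.
  by move: h; congr (0 <= _); ring.
have := pM y; rewrite le_eqVlt => /predU1P[y0|y0]; last first.
  by have := key x y; rewrite ler_pM2l.
have := pM x; rewrite le_eqVlt => /predU1P[x0|x0]; last first.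
  by have := key y x; rewrite ler_pM2l// (bfC y x sM) [leRHS]mulrC.
(* Both forms vanish: the form at [x - bf M x y *: y] is [-2 * bf M x y ^+ 2], and its nonnegativity
   forces [bf M x y] to be zero. *)
rewrite -x0 mul0r; have := pM (x + (- bf M x y) *: y).
rewrite qfD// qfZ bfZr -x0 -y0; nra.
Qed.

Lemma mulmx_pdmx_inj A x : pdmx A -> A *m x = 0 -> x = 0.
Proof.
move=> [_ pA] Ax; apply/eqP; apply/negPn/negP => /pA.
by rewrite /qf -mulmxA Ax mulmx0 mxE ltxx.
Qed.

Lemma pdmx_unit A : pdmx A -> A \in unitmx.
Proof.
move=> pA; rewrite -row_free_unit -kermx_eq0; apply/rowV0P => v /sub_kermxP vA.
apply: trmx_inj; rewrite trmx0; apply: (mulmx_pdmx_inj pA).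
by rewrite -{1}[A]pA.1 -trmx_mul vA trmx0.
Qed.

Lemma symmx_inv A : symmx A -> symmx (invmx A).
Proof. by move=> sA; rewrite /symmx trmx_inv sA. Qed.

Lemma qf_invmx A x : pdmx A -> qf (invmx A) x = qf A (invmx A *m x).
Proof.
move=> pA; rewrite qf_mulmx (symmx_inv pA.1) mulVmx ?pdmx_unit//.
by rewrite mul1mx.
Qed.

(** Writing [x] as [A *m (invmx A *m x)] turns the dot product into a value of the form of [A]. *)
Lemma dot_cauchy_schwarz A x y : pdmx A ->
  bf 1%:M x y ^+ 2 <= qf (invmx A) x * qf A y.
Proof.
move=> pA; rewrite qf_invmx// -[bf _ _ _](_ : bf A (invmx A *m x) y = _).
  exact/psdmx_cauchy_schwarz/pdmx_psdmx.
by rewrite bf_mull (symmx_inv pA.1) mulVmx ?pdmx_unit.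
Qed.

Lemma qf_bound A : exists2 C : R, 0 < C & forall x, qf A x <= C * qf 1%:M x.
Proof.
(* The summand 1 makes the constant strictly positive, hence invertible. *)
exists (1 + \sum_i \sum_j `|A i j|).
  by rewrite ltr_pwDl// sumr_ge0// => i _; rewrite sumr_ge0.
move=> x; rewrite mulrDl mul1r ler_wpDl ?qf1_ge0//.
rewrite {1}/qf -mulmxA mxE mulr_suml ler_sum// => i _.
rewrite !mxE mulr_sumr mulr_suml ler_sum// => j _.
have leq k : x k 0 ^+ 2 <= qf 1%:M x.
  by rewrite qf1E (bigD1 k)//= lerDl sumr_ge0// => ? _; exact: sqr_ge0.
have := leq i; have := leq j; set u := x i 0; set v := x j 0; set q := qf _ _.
move=> vq uq; have uv : `|u * v| <= q.
  by rewrite ler_norml; apply/andP; split;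
    have := sqr_ge0 (u + v); have := sqr_ge0 (u - v); nra.
rewrite mulrCA; apply: (le_trans (ler_norm _)); rewrite normrM.
by rewrite ler_wpM2l.
Qed.

End QuadraticForms.

(** * The largest eigenvalue and Rayleigh bounds *)

Section LambdaMax.
Variables (R : realType) (d : nat).
Hypothesis d_gt0 : (0 < d)%N.
Implicit Types (M A B : 'M[R]_d) (x y : 'cV[R]_d) (a : R).

Lemma cV_neq0 : exists x : 'cV[R]_d, x != 0.
Proof.
exists (const_mx 1); apply/eqP => /matrixP /(_ (Ordinal d_gt0) 0) /eqP.
by rewrite !mxE oner_eq0.
Qed.

(* A psd invertible matrix is bounded below by a positive multiple of the
   identity: apply Cauchy-Schwarz in A to x and A^-1 x. *)
Lemma psdmx_unit_lower_bound A : psdmx A -> A \in unitmx ->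
  exists2 c : R, 0 < c & forall x, c * qf 1%:M x <= qf A x.
Proof.
move=> pA uA; have [C C0 hC] := qf_bound (invmx A).
exists C^-1; first by rewrite invr_gt0.
move=> x; have := psdmx_cauchy_schwarz (invmx A *m x) x pA.
rewrite bf_mull qf_mulmx (symmx_inv pA.1) mulVmx// mul1mx => h.
have := hC x; have := pA.2 x; have := qf1_ge0 x; move: h.
rewrite bfxx; set q := qf 1%:M x; set a := qf A x; set b := qf _ x => h q0 a0 bC.
rewrite mulrC ler_pdivrMr//.
move: q0; rewrite le_eqVlt => /predU1P[<-|q0]; first by rewrite mulr_ge0// ltW.
rewrite -(ler_pM2l q0) -expr2 (le_trans h)//.
rewrite [leRHS](_ : _ = (C * q) * a); last by ring.
by rewrite ler_wpM2r.
Qed.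

(* The infimum of the t such that t I - M is psd is an eigenvalue, since
   otherwise the lower bound above would allow a smaller t. *)
Lemma rayleigh_lambda_max M x : symmx M -> qf M x <= lambda_max M * qf 1%:M x.
Proof.
move=> sM.
pose S := [set t : R | forall y, qf M y <= t * qf 1%:M y].
have [C _ hC] := qf_bound M; have [C' _ hC'] := qf_bound (- M).
have S0 : S !=set0 by exists C.
have Slb : has_lbound S.
  have [y /qf1_gt0 y0] := cV_neq0.
  exists (- C') => t /(_ y) ty; rewrite -(ler_pM2r y0) (le_trans _ ty)//.
  by have := hC' y; rewrite -scaleN1r qfMZ; lra.
set m := inf S.
have Sm : S m.
  move=> y; have := qf1_ge0 y; rewrite le_eqVlt => /predU1P[y0|y0].
    by have := hC y; rewrite -y0 !mulr0.
  rewrite -ler_pdivrMr//; apply: lb_le_inf => // t /(_ y).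
  by rewrite ler_pdivrMr.
have pS : psdmx (m%:M - M).
  split; first by rewrite /symmx linearB /= tr_scalar_mx sM.
  by move=> y; rewrite qfMB -[m%:M]scalemx1 qfMZ subr_ge0.
have nu : m%:M - M \notin unitmx.
  apply/negP => /(psdmx_unit_lower_bound pS) [c c0 hc].
  have : S (m - c).
    move=> y; have := hc y; rewrite qfMB -[m%:M]scalemx1 qfMZ; lra.
  by move/(ge_inf Slb); rewrite -/m; lra.
have ev : eigenvalue M m.
  have : kermx (m%:M - M) != 0 by rewrite kermx_eq0 row_free_unit.
  case/rowV0Pn => v /sub_kermxP; rewrite mulmxBr mul_mx_scalar => /eqP.
  by rewrite subr_eq0 => /eqP vM v0; apply/eigenvalueP; exists v.
(* The spectrum is then nonempty and bounded above, so the [sup] in [lambda_max] is genuine and not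
   a default value. *)
have ub : ubound [set a | eigenvalue M a] m.
  move=> a /= /eigenvalueP [v vM v0].
  have v0' : v^T != 0 by rewrite -trmx0 (inj_eq trmx_inj).
  by have := Sm v^T; rewrite (qf_eigenvector vM) ler_pM2r// qf1_gt0.
apply: (le_trans (Sm x)); rewrite ler_wpM2r ?qf1_ge0//.
by apply: ub_le_sup => //; exists m.
Qed.

Lemma lambda_max_ge0 M : psdmx M -> 0 <= lambda_max M.
Proof.
move=> [sM pM]; have [x /qf1_gt0 x0] := cV_neq0.
by rewrite -(ler_pM2r x0) mul0r (le_trans (pM x))// rayleigh_lambda_max.
Qed.

(** Cauchy-Schwarz of [x] with itself gives |x|^4 <= |x|_{A^-1}^2 |x|_A^2; the Rayleigh bound on the
    last factor lets one |x|^2 cancel. *)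
Lemma qf1_le_lambda_max A x : pdmx A -> qf 1%:M x <= lambda_max A * qf (invmx A) x.
Proof.
move=> pA; have := qf1_ge0 x; rewrite le_eqVlt => /predU1P[x0|x0].
  rewrite -x0 mulr_ge0 ?lambda_max_ge0//; first exact: pdmx_psdmx.
  by rewrite qf_invmx//; exact: (pdmx_psdmx pA).2.
rewrite -(ler_pM2r x0) -expr2; apply: (le_trans (dot_cauchy_schwarz x x pA)).
rewrite mulrC mulrAC ler_wpM2r//; last exact: rayleigh_lambda_max _ pA.1.
by rewrite qf_invmx//; exact: (pdmx_psdmx pA).2.
Qed.

End LambdaMax.

(** * Square roots of positive semidefinite matrices *)

Section Sqrt.
Variable R : realType.

(** Newton interpolation: a new node is corrected by a multiple of the product polynomial vanishing
    at the old ones. *)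
Lemma poly_interpolation (F : fieldType) (s : seq F) (g : F -> F) :
  exists q : {poly F}, forall x, x \in s -> q.[x] = g x.
Proof.
elim: s => [|a s [q hq]]; first by exists 0.
have [as_|as_] := boolP (a \in s).
  by exists q => x; rewrite in_cons => /predU1P[->|]; exact: hq.
pose r := \prod_(b <- s) ('X - b%:P).
have ra : r.[a] != 0 by rewrite -/(root r a) root_prod_XsubC.
exists (q + ((g a - q.[a]) / r.[a]) *: r) => x.
rewrite in_cons hornerD hornerZ => /predU1P[->|xs].
  by rewrite divfK// addrC subrK.
have /eqP -> : r.[x] == 0 by rewrite -/(root r x) root_prod_XsubC.
by rewrite mulr0 addr0 hq.
Qed.

Lemma horner_mx_tr (d : nat) (A : 'M[R]_d.+1) (q : {poly R}) :
  symmx A -> symmx (horner_mx A q).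
Proof.
move=> sA; rewrite /symmx; elim/poly_ind: q => [|q c IH].
  by rewrite rmorph0 trmx0.
rewrite rmorphD rmorphM /= horner_mx_C horner_mx_X linearD /= tr_scalar_mx.
congr (_ + _); rewrite -mulmxE trmx_mul sA IH.
by apply/comm_mx_sym/comm_horner_mx/comm_mx_refl.
Qed.

Lemma mulmx_uconj (F : fieldType) (n : nat) (P U V : 'M[F]_n) : P \in unitmx ->
  (invmx P *m U *m P) *m (invmx P *m V *m P) = invmx P *m (U *m V) *m P.
Proof. by move=> uP; rewrite !mulmxA mulmxK. Qed.

(** The diagonalization lives over [rF], but the interpolating polynomial has coefficients in [aF],
    so the root is a matrix over [aF]. *)
Lemma horner_mx_fourth_root (aF rF : fieldType) (f : {rmorphism aF -> rF}) (n : nat)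
    (M : 'M[aF]_n.+1) (P : 'M[rF]_n.+1) (r : 'rV[aF]_n.+1) (g : aF -> aF) :
  P \in unitmx -> map_mx f M = invmx P *m diag_mx (map_mx f r) *m P ->
  (forall i, (g (r 0 i) * g (r 0 i)) * (g (r 0 i) * g (r 0 i)) = r 0 i) ->
  exists q, let Y := horner_mx M q in (Y *m Y) *m (Y *m Y) = M.
Proof.
move=> uP ME gr.
have [q hq] := poly_interpolation [seq r 0 i | i : 'I_n.+1] g.
exists q => /=; apply: (@map_mx_inj _ _ f); rewrite !map_mxM map_horner_mx.
rewrite ME horner_mx_uconjC// horner_mx_diag !mulmx_uconj// !mulmx_diag.
congr (_ *m diag_mx _ *m _); apply/rowP => i.
rewrite !mxE horner_map /= hq; first by rewrite -!rmorphM gr.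
by apply/mapP; exists i; rewrite // mem_enum.
Qed.

(* Over R[i] the matrix is unitarily diagonalizable with nonnegative real
   eigenvalues; a real polynomial sending each eigenvalue to its fourth root
   yields a symmetric Y with Y^4 = M, and Y^2 is psd. *)
Lemma psd_sqrt_exists (d : nat) (M : 'M[R]_d) : psdmx M ->
  exists X : 'M[R]_d, psdmx X /\ X *m X = M.
Proof.
case: d M => [|d] M pM.
  exists M; split=> //; by apply/matrixP => - [].
pose toC := real_complex R.
pose A := map_mx toC M.
have sA : A \is hermsymmx.
  apply: realsym_hermsym.
    apply/is_hermitianmxP; rewrite expr0 scale1r map_mx_id //.
    by rewrite /A map_trmx pM.1.
  by apply/mxOverP => i j; rewrite mxE complex_real.
have /hermitian_spectral_diag_real/mxOverP spR := sA.
have uP : spectralmx A \in unitmx := spectral_unit A.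
have /orthomx_spectralP AE := hermitian_normalmx sA.
move: spR uP AE; set P := spectralmx A; set sp := spectral_diag A => spR uP AE.
(* Each row of [P] is a left eigenvector. The eigenvalue is real, so it also has an eigenvector over
   [R], where [M] is known to be psd. *)
have sp_ge0 i : 0 <= complex.Re (sp 0 i).
  have : eigenvalue A (sp 0 i).
    apply/eigenvalueP; exists (row i P); last first.
      by apply: contraTneq uP => Pi0; rewrite -row_free_unit; apply/row_freePn;
         exists i; rewrite Pi0 sub0mx.
    rewrite {1}AE -row_mul !mulmxA mulmxV// mul1mx row_mul row_diag_mx.
    by rewrite -scalemxAl -rowE.
  rewrite -(RRe_real (spR 0 i)) eigenvalue_map => /eigenvalueP [v vM v0].
  have v0' : v^T != 0 by rewrite -trmx0 (inj_eq trmx_inj).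
  by have := pM.2 v^T; rewrite (qf_eigenvector vM) pmulr_lge0// qf1_gt0.
have rE : sp = map_mx toC (map_mx (@complex.Re R) sp).
  by apply/rowP => i; rewrite !mxE; exact/esym/RRe_real.
rewrite rE in AE.
have [|q] := horner_mx_fourth_root (g := fun r => Num.sqrt (Num.sqrt r)) uP AE.
  by move=> i; rewrite mxE -!expr2 !sqr_sqrtr ?sqrtr_ge0.
set Y := horner_mx M q => /= YE.
have sY : symmx Y by exact: horner_mx_tr pM.1.
exists (Y *m Y); split=> //.
split; first by rewrite /symmx trmx_mul sY.
by move=> x; rewrite -[Y in Y *m _]sY -[Y^T]mulmx1 -qf_mulmx; exact: qf1_ge0.
Qed.

Lemma psd_sqrtP (d : nat) (M : 'M[R]_d) : psdmx M ->
  psdmx (psd_sqrt M) /\ psd_sqrt M *m psd_sqrt M = M.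
Proof.
move=> pM; have [X hX] := psd_sqrt_exists pM.
have [//|ps sq] := @xgetPex _ 0 [set X | psdmx X /\ X *m X = M].
  by exists X.
by split.
Qed.

(** The Rayleigh bound for L^{-1/2} A L^{-1/2} is evaluated at L^{1/2} x, whose squared norm is
    [qf L x]. *)
Lemma qf_le_relative_lambda_max (d : nat) (A L : 'M[R]_d) (x : 'cV[R]_d) :
  (0 < d)%N -> symmx A -> pdmx L ->
  qf A x <= lambda_max (invmx (psd_sqrt L) *m A *m invmx (psd_sqrt L)) * qf L x.
Proof.
move=> d0 sA pL; have [[sX _] XX] := psd_sqrtP (pdmx_psdmx pL).
move: sX XX; set X := psd_sqrt L => sX XX.
have uX : X \in unitmx.
  by have := pdmx_unit pL; rewrite -XX unitmx_mul => /andP[].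
have sXi := symmx_inv sX.
have := rayleigh_lambda_max d0 (M := invmx X *m A *m invmx X) (X *m x).
rewrite !qf_mulmx sX mulmx1 XX !mulmxA mulmxV// mul1mx mulmxKV//; apply.
by rewrite /symmx !trmx_mul sXi sA mulmxA.
Qed.
End Sqrt.

(** * Gradients and the descent inequality *)

Section Descent.
Variables (R : realType) (d : nat).
Implicit Types (L : 'M[R]_d) (f : 'cV[R]_d -> R) (g : 'cV[R]_d -> 'cV[R]_d).

Lemma lipschitz_gradP L g x y : pdmx L -> lipschitz_grad L g ->
  qf (invmx L) (g x - g y) <= qf L (x - y).
Proof.
by move=> pL /(_ x y); rewrite ler_sqrt//; exact: (pdmx_psdmx pL).2.
Qed.

(** The difference quotient along the line at [t] is the directional one of [f] at [x + t *: v]. *)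
Lemma is_derive_line f g x v t : is_gradient f g ->
  is_derive t (1 : R) (fun s : R => f (x + s *: v)) (bf 1%:M (g (x + t *: v)) v).
Proof.
move=> /(_ (x + t *: v)) [df dfE].
have quot : (fun h : R => h^-1 *: (f (x + (h *: (1 : R) + t) *: v) - f (x + t *: v)))
   = (fun h : R => h^-1 *: (f (h *: v + (x + t *: v)) - f (x + t *: v))).
  apply/funext => h; congr (_ *: (f _ - _)).
  have -> : h *: (1 : R) = h by rewrite /GRing.scale /= mulr1.
  by rewrite scalerDl addrCA.
have := @diff_derivable _ _ _ _ _ v df; rewrite /derivable -quot => dv.
split; first exact: dv.
rewrite /bf mulmx1 -dfE -deriveE// /derive.
exact: (congr1 (fun q : R -> R => lim (q h @[h --> 0^'])) quot).
Qed.

Lemma is_gradient0 : is_gradient (fun _ : 'cV[R]_d => 0) (fun _ => 0).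
Proof.
move=> x; split; first exact: differentiable_cst.
by move=> v; rewrite diff_cst trmx0 mul0mx mxE.
Qed.

Lemma is_gradientD f1 f2 g1 g2 : is_gradient f1 g1 -> is_gradient f2 g2 ->
  is_gradient (fun x => f1 x + f2 x) (fun x => g1 x + g2 x).
Proof.
move=> fg1 fg2 x; have [d1 e1] := fg1 x; have [d2 e2] := fg2 x.
split; first exact: differentiableD.
move=> v; by rewrite (diffD d1 d2) /= e1 e2 linearD /= mulmxDl [RHS]mxE.
Qed.

Lemma is_gradientZ (a : R) f g : is_gradient f g ->
  is_gradient (fun x => a * f x) (fun x => a *: g x).
Proof.
move=> fg x; have [df e] := fg x; split; first exact: differentiableZ.
move=> v; by rewrite (diffZ a df) /= e linearZ /= -scalemxAl [RHS]mxE.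
Qed.

Lemma is_gradient_sum (I : Type) (s : seq I) (fi : I -> 'cV[R]_d -> R) gi :
  (forall i, is_gradient (fi i) (gi i)) ->
  is_gradient (fun x => \sum_(i <- s) fi i x) (fun x => \sum_(i <- s) gi i x).
Proof.
move=> fg; elim: s => [|i s IH].
  rewrite (_ : (fun x => _) = fun=> 0); last by apply/funext => x; rewrite big_nil.
  rewrite [X in is_gradient _ X](_ : _ = fun=> 0); last by apply/funext => x; rewrite big_nil.
  exact: is_gradient0.
rewrite (_ : (fun x => _) = fun x => fi i x + \sum_(j <- s) fi j x); last first.
  by apply/funext => x; rewrite big_cons.
rewrite [X in is_gradient _ X](_ : _ = fun x => gi i x + \sum_(j <- s) gi j x); last first.
  by apply/funext => x; rewrite big_cons.
exact: is_gradientD.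
Qed.

(** The mean value theorem is applied to [psi], which is [f] on the segment minus its quadratic
    model; its derivative is nonpositive on ]0, 1[, so [psi 1 <= psi 0]. *)
Lemma descent_lemma f g L x v :
  is_gradient f g -> pdmx L -> lipschitz_grad L g ->
  f (x + v) <= f x + bf 1%:M (g x) v + 2^-1 * qf L v.
Proof.
move=> fg pL gL; set c := bf _ _ _; set q := qf L v.
have q0 : 0 <= q := (pdmx_psdmx pL).2 v.
pose psi (t : R) := f (x + t *: v) - (c * t + 2^-1 * q * t ^+ 2).
have dpsi (t : R) : is_derive t (1 : R) psi (bf 1%:M (g (x + t *: v)) v - (c + q * t)).
  have h1 := is_derive_line x v t fg.
  rewrite /psi; apply: is_deriveB.
  by apply: is_derive_eq; rewrite /GRing.scale /=; field.
have [//||s] := @MVT R psi (fun t => bf 1%:M (g (x + t *: v)) v - (c + q * t)) 0 1.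
- apply: derivable_within_continuous => t _.
  exact: (@ex_derive _ _ _ _ _ _ _ (dpsi t)).
rewrite in_itv /= => /andP[s0 s1].
(* Cauchy-Schwarz and the Lipschitz bound give a square of at most [s ^+ 2 * q * q]. *)
have step : bf 1%:M (g (x + s *: v)) v - c <= s * q.
  have -> : bf 1%:M (g (x + s *: v)) v - c = bf 1%:M (g (x + s *: v) - g x) v.
    by rewrite bfDl bfNl.
  have := dot_cauchy_schwarz (g (x + s *: v) - g x) v pL.
  have := lipschitz_gradP (x + s *: v) x pL gL.
  have -> : x + s *: v - x = s *: v by rewrite addrAC subrr add0r.
  rewrite qfZ -/q => h1 h2; apply: le_trans (ler_norm _) _.
  rewrite -ler_sqr ?nnegrE ?mulr_ge0 ?(ltW s0)// real_normK ?num_real//.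
  apply: (le_trans h2); rewrite exprMn [q ^+ 2]expr2 mulrA ler_wpM2r//.
rewrite /psi scale1r scale0r addr0; lra.
Qed.

End Descent.

(** * Expectations over independent sketches *)

Section Expectation.
Variables (R : realType) (d : nat) (dO : measure_display)
  (Omega : measurableType dO) (mu : probability Omega R).
Local Open Scope ereal_scope.

(* Unlike [ge0_le_integral], this needs no measurability: the integral of a
   nonnegative function is a supremum over the simple functions below it. *)
Lemma le_integral_ge0 (f g : Omega -> \bar R) :
  (forall w, 0 <= f w) -> (forall w, f w <= g w) ->
  \int[mu]_w f w <= \int[mu]_w g w.
Proof.
move=> f0 fg; rewrite !ge0_integralTE//; last by move=> w; exact: le_trans (fg w).
by apply: ereal_sup_le => _ [h /= hf <-]; exists h => // w; exact: le_trans (fg w).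
Qed.

Lemma Eprod_ge0 (sigma : Omega -> 'M[R]_d) m F :
  (forall s, 0 <= F s) -> 0 <= Eprod mu sigma m F.
Proof.
elim: m F => [|m IH] F F0 //=; apply: integral_ge0 => w _.
by apply: IH => s.
Qed.

(** Asking no measurability of [F] and [G] allows [W] to be bounded inside the expectation. *)
Lemma le_Eprod (sigma : Omega -> 'M[R]_d) m F G :
  (forall s, 0 <= F s) -> (forall s, F s <= G s) ->
  Eprod mu sigma m F <= Eprod mu sigma m G.
Proof.
elim: m F G => [|m IH] F G F0 FG //=; apply: le_integral_ge0 => w.
  by apply: Eprod_ge0 => s.
by apply: IH => s.
Qed.

Lemma eq_Eprod (sigma : Omega -> 'M[R]_d) m F G : F =1 G ->
  Eprod mu sigma m F = Eprod mu sigma m G.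
Proof. by move=> /funext ->. Qed.

Lemma integral_EFin (f : Omega -> R) : mu.-integrable setT (EFin \o f) ->
  \int[mu]_w (f w)%:E = (Rintegral mu setT f)%:E.
Proof. by move=> fi; rewrite /Rintegral fineK//; exact: integrable_fin_num. Qed.

Lemma bf_sum (M : 'M[R]_d) x y :
  (bf M x y = \sum_j \sum_i x i 0 * y j 0 * M i j)%R.
Proof.
rewrite /bf mxE; apply: eq_bigr => j _; rewrite mxE mulr_suml.
by apply: eq_bigr => i _; rewrite mxE; ring.
Qed.

Lemma integrable_bf (M : Omega -> 'M[R]_d) x y :
  (forall i j, mu.-integrable setT (fun w => (M w i j)%:E)) ->
  mu.-integrable setT (fun w => (bf (M w) x y)%:E).
Proof.
move=> iM; have -> : (fun w => (bf (M w) x y)%:E)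
    = (fun w => \sum_j \sum_i (x i 0 * y j 0)%:E * (M w i j)%:E).
  apply/funext => w; rewrite bf_sum -sumEFin; apply: eq_bigr => j _.
  by rewrite -sumEFin.
do 2! (apply: integrable_sum => // ? _).
exact: integrableZl.
Qed.

Lemma Rintegral_bf (M : Omega -> 'M[R]_d) x y :
  (forall i j, mu.-integrable setT (fun w => (M w i j)%:E)) ->
  (Rintegral mu setT (fun w => bf (M w) x y)
    = bf (\matrix_(i, j) Rintegral mu setT (fun w => M w i j)) x y)%R.
Proof.
move=> iM; apply: EFin_inj; rewrite -integral_EFin; last exact: integrable_bf.
rewrite (_ : (fun w => _)
    = (fun w => \sum_j \sum_i (x i 0 * y j 0)%:E * (M w i j)%:E)); last first.
  apply/funext => w; rewrite bf_sum -sumEFin; apply: eq_bigr => j _.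
  by rewrite -sumEFin.
rewrite bf_sum -sumEFin integral_sum//; last first.
  by move=> j; apply: integrable_sum => // i _; exact: integrableZl.
apply: eq_bigr => j _; rewrite -sumEFin integral_sum//; last first.
  by move=> i; exact: integrableZl.
apply: eq_bigr => i _; rewrite integralZl//.
rewrite integral_EFin; last exact: iM.
by rewrite mxE EFinM.
Qed.

Section Sketch.
Variable sigma : Omega -> 'M[R]_d.
Hypothesis hsigma : is_sketch_distribution mu sigma.

(** A product is dominated by the sum of the two squares. *)
Lemma integrable_sketchM i j k l :
  mu.-integrable setT (fun w => (sigma w i j * sigma w k l)%:E).
Proof.
have [ms [_ [_ [_ s2]]]] := hsigma.
apply: le_integrable (integrableD measurableT (s2 i j) (s2 k l)) => //.
  by apply/measurable_EFinP; apply: measurable_funM.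
move=> w _; rewrite /= lee_fin [leRHS]ger0_norm ?addr_ge0 ?sqr_ge0//.
set a := sigma w i j; set b := sigma w k l.
rewrite ler_norml; apply/andP; split;
  have := sqr_ge0 (a + b); have := sqr_ge0 (a - b);
  have := sqr_ge0 a; have := sqr_ge0 b; nra.
Qed.

Lemma integrable_sketch_conj (D : 'M[R]_d) i j :
  mu.-integrable setT (fun w => ((sigma w *m D *m sigma w) i j)%:E).
Proof.
have -> : (fun w => ((sigma w *m D *m sigma w) i j)%:E)
    = (fun w => \sum_k \sum_l (D l k)%:E * (sigma w i l * sigma w k j)%:E).
  apply/funext => w; rewrite mxE -sumEFin; apply: eq_bigr => k _.
  rewrite mxE mulr_suml -sumEFin; apply: eq_bigr => l _.
  by rewrite -EFinM; congr EFin; ring.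
do 2! (apply: integrable_sum => // ? _).
by apply: integrableZl => //; exact: integrable_sketchM.
Qed.

(** Bias-variance identity: as E[S] = I, the cross term vanishes and E[(S - I) D (S - I)] = E[S D S]
    - D. *)
Lemma integral_sketch_qf (D : 'M[R]_d) (a c : R) (v u : 'cV[R]_d) : symmx D ->
  \int[mu]_w (a + c * qf D (v + (sigma w - 1%:M) *m u))%:E
  = (a + c * (qf D v + qf (Emx mu sigma (fun S => S *m D *m S) - D) u))%:E.
Proof.
move=> sD; have [_ [ps [iS [ES _]]]] := hsigma.
pose V (w : Omega) := (sigma w *m D *m sigma w)%R.
have iV := integrable_sketch_conj D.
(* The sketch-free part, [a + c * qf D (v - u)] expanded. *)
pose A := (a + c * (qf D v - 2 * bf D v u + qf D u))%R.
have E w : (a + c * qf D (v + (sigma w - 1%:M) *m u))%:E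
    = A%:E + ((2 * c)%:E * (bf (sigma w) (D *m (v - u)) u)%:E + c%:E * (bf (V w) u u)%:E).
  rewrite -!EFinM -!EFinD; congr EFin.
  have -> : (bf (sigma w) (D *m (v - u)) u = bf D (v - u) (sigma w *m u))%R.
    by rewrite bf_mull sD bf_mulr.
  have -> : (bf (V w) u u = qf D (sigma w *m u))%R.
    by rewrite bfxx qf_mulmx (ps w).1.
  rewrite mulmxBl mul1mx !qfD// qfN !bfDr !bfDl !bfNr !bfNl (bfC (sigma w *m u) u sD) /A.
  ring.
under eq_integral do rewrite E.
have i1 := integrable_bf (D *m (v - u)) u iS.
have i2 := integrable_bf u u iV.
rewrite integralD//; first last.
- by apply: integrableD => //; exact: integrableZl.
- exact: finite_measure_integrable_cst.
rewrite integralD//; try exact: integrableZl.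
rewrite !integralZl// integral_cst// [X in _ * X]probability_setT mule1.
rewrite (integral_EFin i1) (integral_EFin i2) !Rintegral_bf// -!EFinM -!EFinD; congr EFin.
have -> : \matrix_(i, j) Rintegral mu setT (fun w => sigma w i j) = 1%:M.
  by apply/matrixP => i j; rewrite !mxE ES.
rewrite -/(Emx mu sigma (fun S => S *m D *m S)) bf_mull sD mulmx1 bfDl bfNl !bfxx qfMB /A.
ring.
Qed.

(** Independence makes the variances add up. In the induction [v] absorbs the term of the outermost
    sketch, and [a] the variances already integrated. *)
Lemma Eprod_qf (D : 'M[R]_d) (a c : R) m (u : nat -> 'cV[R]_d) v : symmx D ->
  Eprod mu sigma m
    (fun s => (a + c * qf D (v + \sum_(j < m) (s j - 1%:M) *m u j))%:E)
  = (a + c * (qf D v + \sum_(j < m) qf (Emx mu sigma (fun S => S *m D *m S) - D) (u j)))%:E.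
Proof.
move=> sD; elim: m a v => [|m IH] a v /=; first by rewrite !big_ord0 !addr0.
under eq_integral => w _.
  rewrite (@eq_Eprod _ _ _ (fun s => (a + c * qf D ((v + (sigma w - 1%:M) *m u m)
      + \sum_(j < m) (s j - 1%:M) *m u j))%:E)); last first.
    move=> s; rewrite big_ord_recr /= eqxx; congr (a + c * qf D _)%:E.
    rewrite [X in (_ + X)%R]addrC addrA; congr (_ + _)%R.
    by apply: eq_bigr => j _; rewrite ltn_eqF.
  rewrite IH mulrDr addrA addrAC.
  over.
rewrite integral_sketch_qf//; congr EFin; rewrite big_ord_recr /=; ring.
Qed.

(** The value is the expectation of |(S - I) u|_D^2. *)
Lemma qf_sketch_var_ge0 (D : 'M[R]_d) u : psdmx D ->
  (0 <= qf (Emx mu sigma (fun S => S *m D *m S) - D) u)%R.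
Proof.
move=> pD; have := integral_sketch_qf 0 1 0 u pD.1.
have -> : qf D 0 = 0%R by rewrite /qf mulmx0 mxE.
rewrite !add0r mul1r => h; rewrite -lee_fin -h.
by apply: integral_ge0 => w _; rewrite lee_fin add0r mul1r add0r; exact: pD.2.
Qed.

Lemma symmx_sketch_var (D : 'M[R]_d) : symmx D ->
  symmx (Emx mu sigma (fun S => S *m D *m S) - D).
Proof.
move=> sD; have [_ [ps _]] := hsigma; rewrite /symmx linearB /= sD; congr (_ - _)%R.
apply/matrixP => i j; rewrite !mxE; congr Rintegral; apply/funext => w.
transitivity ((sigma w *m D *m sigma w)^T i j)%R; first by rewrite [RHS]mxE.
by rewrite !trmx_mul sD (ps w).1 mulmxA.
Qed.
End Sketch.
End Expectation.

(** * One-step estimates and convergence of det-MARINA *)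

(** One factor per change of norm: from V to Euclidean, to A^-1, by Lipschitz continuity to A, and
    finally to L. *)
Lemma sketch_variance_bound (R : realType) (d : nat) (A L V : 'M[R]_d) g x y :
  (0 < d)%N -> pdmx A -> pdmx L -> psdmx V -> lipschitz_grad A g ->
  qf V (g x - g y) <= lambda_max A
    * lambda_max (invmx (psd_sqrt L) *m A *m invmx (psd_sqrt L))
    * lambda_max V * qf L (x - y).
Proof.
move=> d0 pA pL pV gA; apply: (le_trans (rayleigh_lambda_max d0 _ pV.1)).
rewrite mulrAC [leRHS]mulrC ler_wpM2l ?lambda_max_ge0//.
apply: (le_trans (qf1_le_lambda_max d0 _ pA)); rewrite -mulrA.
rewrite ler_wpM2l ?lambda_max_ge0//; first exact: pdmx_psdmx.
apply: (le_trans (lipschitz_gradP _ _ pA gA)).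
exact: qf_le_relative_lambda_max pA.1 pL.
Qed.

(** The condition on [D] is evaluated at the step [D *m g]. As (1-p)/(2p) = 1/(2p) - 1/2, half of
    the squared error is released and pays for the error in the descent inequality. *)
Lemma lyapunov_descent (R : realType) (d : nat) (L D : 'M[R]_d) f gF (p r : R) x g :
  is_gradient f gF -> pdmx L -> lipschitz_grad L gF -> 0 < p -> pdmx D ->
  psdmx (invmx D - (r + 1) *: L) ->
  f (x - D *m g) + (1 - p) * (2 * p)^-1 * qf D (g - gF x) + 2^-1 * r * qf L (D *m g)
    <= f x + (2 * p)^-1 * qf D (g - gF x) - 2^-1 * qf D (gF x).
Proof.
move=> fg pL gL p0 pD [_ /(_ (D *m g))].
rewrite qfMB qfMZ qf_invmx// mulKmx ?pdmx_unit//.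
have := descent_lemma x (- (D *m g)) fg pL gL.
rewrite qfN bfNr bf_mulr mul1mx (qfD _ _ pD.1) qfN bfNr (bfC _ _ pD.1).
have -> : (1 - p) * (2 * p)^-1 = (2 * p)^-1 - 2^-1 by field; exact: lt0r_neq0.
set ip := (2 * p)^-1.
lra.
Qed.

Lemma W_ge0 (R : realType) (d : nat) (dO : measure_display) (Omega : measurableType dO)
    (mu : probability Omega R) (sigma : Omega -> 'M[R]_d) (n : nat)
    (gf : 'I_n -> 'cV[R]_d -> 'cV[R]_d) (D : 'M[R]_d) (p : R) (h : 'cV[R]_d -> R)
    m x g :
  0 <= p <= 1 -> (forall x, 0 <= h x) -> (0 <= W mu sigma gf D p h m x g)%E.
Proof.
move=> /andP[p0 p1] h0; elim: m x g => [|m IH] x g //=.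
rewrite !adde_ge0 ?mule_ge0 ?lee_fin ?subr_ge0//.
by apply: Eprod_ge0 => s.
Qed.

(** The new error is the old one plus the average of (S_i - I) applied to the gradient differences;
    averaging puts n^-2 before the variances. *)
Lemma Eprod_error (R : realType) (d : nat) (dO : measure_display)
    (Omega : measurableType dO) (mu : probability Omega R) (sigma : Omega -> 'M[R]_d)
    (n : nat) (gf : 'I_n -> 'cV[R]_d -> 'cV[R]_d) (D : 'M[R]_d) (a c : R) x x' g :
  (0 < n)%N -> is_sketch_distribution mu sigma -> symmx D ->
  Eprod mu sigma n (fun s => (a + c * qf D (n%:R^-1 *:
      \sum_(i < n) (g + s i *m (gf i x' - gf i x)) - gradf gf x'))%:E)
  = (a + c * (qf D (g - gradf gf x) + n%:R ^- 2 * \sum_(i < n)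
      qf (Emx mu sigma (fun S => S *m D *m S) - D) (gf i x' - gf i x)))%:E.
Proof.
move=> n0 hs sD.
have nR : n%:R != 0 :> R by rewrite pnatr_eq0 -lt0n.
(* Extension by zero to all naturals, the index type of [Eprod_qf]. *)
pose u (j : nat) : 'cV[R]_d :=
  if insub j is Some i then n%:R^-1 *: (gf i x' - gf i x) else 0.
have uE (i : 'I_n) : u i = n%:R^-1 *: (gf i x' - gf i x) by rewrite /u valK.
rewrite (@eq_Eprod _ _ _ _ _ _ _ _ (fun s => (a + c * qf D ((g - gradf gf x)
    + \sum_(j < n) (s j - 1%:M) *m u j))%:E)); last first.
  move=> s; congr (a + c * qf D _)%:E.
  under [in RHS]eq_bigr do rewrite uE -scalemxAr mulmxBl mul1mx.
  rewrite -scaler_sumr big_split /= sumr_const card_ord scalerDr -[g *+ n]scaler_nat.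
  rewrite scalerA mulVf// scale1r sumrB scalerBr sumrB scalerBr -!/(gradf gf _).
  by rewrite opprB -!addrA; congr (_ + _); rewrite [RHS]addrCA addKr.
rewrite (Eprod_qf hs)//; congr (a + c * (_ + _))%:E; rewrite mulr_sumr.
by apply: eq_bigr => i _; rewrite uE qfZ exprVn.
Qed.

Theorem theorem1 (R : realType) (d n K : nat) (hd : (0 < d)%N) (hn : (0 < n)%N)
  (hK : (1 <= K)%N)
  (fi : 'I_n -> 'cV[R]_d -> R) (gf : 'I_n -> 'cV[R]_d -> 'cV[R]_d)
  (Li : 'I_n -> 'M[R]_d) (L D : 'M[R]_d) (fstar p : R) (x0 : 'cV[R]_d)
  (dO : measure_display) (Omega : measurableType dO)
  (mu : probability Omega R) (sigma : Omega -> 'M[R]_d) :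
  let f := fun x => n%:R^-1 * \sum_i fi i x in
  let gF := gradf gf in
  (forall i, is_gradient (fi i) (gf i)) ->
  (forall i, continuous (gf i)) ->
  (forall x, fstar <= f x) ->
  (forall i, pdmx (Li i)) -> pdmx L ->
  (forall i, lipschitz_grad (Li i) (gf i)) ->
  lipschitz_grad L gF ->
  0 < p <= 1 ->
  is_sketch_distribution mu sigma ->
  pdmx D ->
  let Lmh := invmx (psd_sqrt L) in
  let RDS := n%:R^-1 * \sum_i (lambda_max (Li i)
                * lambda_max (Lmh *m Li i *m Lmh)
                * lambda_max (Emx mu sigma (fun S => S *m D *m S) - D)) in
  psdmx (invmx D - ((1 - p) * RDS / (n%:R * p) + 1) *: L) ->
  let dd := powR (\det D) (d%:R^-1) in
  let h := fun x => qf (dd^-1 *: D) (gF x) in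
  ((K%:R^-1)%:E * W mu sigma gf D p h K x0 (gF x0)
     <= (2 * (f x0 - fstar) / (dd * K%:R))%:E)%E.
Proof.
move=> f gF gfi _ f_ge pLi pL gLi gL /andP[p0 p1] hs pD Lmh RDS pR.
pose dd := powR (\det D) (d%:R^-1); pose h := fun x => qf (dd^-1 *: D) (gF x).
change ((K%:R^-1)%:E * W mu sigma gf D p h K x0 (gF x0)
  <= (2 * (f x0 - fstar) / (dd * K%:R))%:E)%E.
have nR : 0 < n%:R :> R by rewrite ltr0n.
have dd0 : 0 <= dd^-1 by rewrite invr_ge0 powR_ge0.
have fgF : is_gradient f gF by apply: is_gradientZ; exact: is_gradient_sum.
have psdD := pdmx_psdmx pD.
have pp : 0 <= (2 * p)^-1 by rewrite invr_ge0 mulr_ge0// ltW.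
set V := Emx mu sigma _ - D in RDS pR.
have pV : psdmx V.
  by split; [exact: symmx_sketch_var pD.1 | move=> u; exact: qf_sketch_var_ge0].
have h_ge0 x : 0 <= h x by rewrite /h qfMZ mulr_ge0// psdD.2.
have W0 m x g : (0 <= W mu sigma gf D p h m x g)%E by apply: W_ge0 => //; rewrite ltW.
(* With this scaling of the Lyapunov function, the decrease per iteration is exactly [h x]. *)
pose k := 2 * dd^-1.
have k0 : 0 <= k by rewrite mulr_ge0.
pose Phi x g := k * (f x - fstar) + k * (2 * p)^-1 * qf D (g - gF x).
(* Telescoping as an induction: from any state, the expected remaining sum is at most [Phi]
   there. *)
have bound m x g : (W mu sigma gf D p h m x g <= (Phi x g)%:E)%E.
  elim: m x g => [|m IH] x g.
    by rewrite lee_fin /Phi addr_ge0 ?mulr_ge0 ?subr_ge0// psdD.2.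
  rewrite /=; set x' := x - D *m g.
  (* After a full-gradient step the error term of [Phi] is zero. *)
  have step1 : (W mu sigma gf D p h m x' (gF x') <= (k * (f x' - fstar))%:E)%E.
    by apply: (le_trans (IH _ _)); rewrite /Phi subrr /qf mulmx0 mxE mulr0 addr0.
  (* After a compressed step, one n^-1 of the n^-2 is the average inside [RDS]. *)
  have step2 : (Eprod mu sigma n (fun s => W mu sigma gf D p h m x'
         (n%:R^-1 *: \sum_(i < n) (g + s i *m (gf i x' - gf i x))))
      <= (k * (f x' - fstar) + k * (2 * p)^-1 *
          (qf D (g - gF x) + n%:R^-1 * RDS * qf L (D *m g)))%:E)%E.
    apply: (le_trans (@le_Eprod _ _ _ _ mu sigma n _ (fun s => (Phi x' (n%:R^-1 *:
      \sum_(i < n) (g + s i *m (gf i x' - gf i x))))%:E) _ _)) => [s|s|] //.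
    rewrite /Phi Eprod_error//; last exact: pD.1.
    rewrite lee_fin lerD2l ler_wpM2l ?mulr_ge0// lerD2l.
    rewrite expr2 invfM -!mulrA ler_wpM2l ?invr_ge0 ?(ltW nR)//.
    rewrite ler_wpM2l ?invr_ge0 ?(ltW nR)// mulr_suml ler_sum// => i _.
    have -> : qf L (D *m g) = qf L (x' - x) by rewrite /x' addrC addKr qfN.
    exact: sketch_variance_bound.
  apply: (@le_trans _ _ ((h x)%:E + p%:E * (k * (f x' - fstar))%:E + (1 - p)%:E *
    (k * (f x' - fstar) + k * (2 * p)^-1 *
       (qf D (g - gF x) + n%:R^-1 * RDS * qf L (D *m g)))%:E)%E).
    by rewrite !leeD// lee_wpmul2l// lee_fin ?subr_ge0// ltW.
  rewrite -!EFinM -!EFinD lee_fin /h qfMZ.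
  (* Here r = (1-p) RDS / (np), so r/2 is the weight (1-p)/(2p) times RDS/n. *)
  have := lyapunov_descent x g fgF pL gL p0 pD pR.
  move/(ler_wpM2l k0); rewrite -subr_ge0 => lyap.
  rewrite -subr_ge0; apply: (le_trans lyap); rewrite le_eqVlt; apply/predU1P; left.
  (* Abstracting [dd^-1] and [RDS] leaves [field] only [p] and [n%:R] to be shown nonzero. *)
  rewrite /Phi /k -/x'; move: (dd^-1) (RDS) (qf L _) => i r q.
  by field; rewrite !lt0r_neq0.
have Wle := bound K x0 (gF x0).
have Kinv : 0 <= K%:R^-1 :> R by rewrite invr_ge0.
(* The initial estimate is the exact gradient, so [Phi] reduces to [k * (f x0 - fstar)]. *)
apply: (@le_trans _ _ ((K%:R^-1)%:E * (Phi x0 (gF x0))%:E)%E).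
  by rewrite lee_wpmul2l// lee_fin.
rewrite -EFinM lee_fin /Phi subrr /qf mulmx0 mxE mulr0 addr0 invfM /k le_eqVlt.
by apply/predU1P; left; ring.
Qed.
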